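(* Let $k\in\{1,2\}$ and $\nu\in\mathfrak{M}_L^k(\mathbb{R}^d)$. Then for every Borel set $B\subset\mathbb{R}^d$, $$\mathcal{A}_k(\nu)(B)=\int_0^1\nu^{(k/2)}(u^{-1}B)\,2\pi^{-1}(1-u^2)^{-1/2}\,\mathrm{d}u,$$ where $u^{-1}B=\{u^{-1}x:x\in B\}$.
   Context: A Lévy measure on $\mathbb{R}^d$ is a measure $\nu$ with $\nu(\{0\})=0$ and $\int(1\wedge|x|^2)\nu(\mathrm{d}x)<\infty$; their class is $\mathfrak{M}_L^2(\mathbb{R}^d)$, and $\mathfrak{M}_L^1(\mathbb{R}^d)$ is the class of Lévy measures with $\int(1\wedge|x|)\nu(\mathrm{d}x)<\infty$. For $s>0$ set $a_1(r;s)=2\pi^{-1}(s-r^2)^{-1/2}$ for $0<r<s^{1/2}$ and $0$ otherwise; $a_2(r;s)=2\pi^{-1}(s^2-r^2)^{-1/2}$ for $0<r<s$ and $0$ otherwise. $\mathcal{A}_k(\nu)(B)=\int_{\mathbb{R}^d\setminus\{0\}}\nu(\mathrm{d}x)\int_0^\infty a_k(r;|x|)1_B(rx/|x|)\,\mathrm{d}r$. For $p>0$, $\nu^{(p)}(B)=\int_{\mathbb{R}^d\setminus\{0\}}1_B(|x|^px/|x|)\nu(\mathrm{d}x)$ (so $\nu^{(1)}=\nu$). *)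

(* Defs.v *)
From HB Require Import structures.
From mathcomp Require Import all_boot all_order all_algebra.
From mathcomp Require Import all_classical all_reals all_analysis.
Set Implicit Arguments. Unset Strict Implicit. Unset Printing Implicit Defensive.
Import Order.TTheory GRing.Theory Num.Theory.
Import numFieldNormedType.Exports.
Local Open Scope classical_set_scope.
Local Open Scope ring_scope.

Definition Rd (R : realType) (d : nat) :=
  g_sigma_algebraType (@open 'rV[R]_d).

Definition enorm (R : realType) (d : nat) (x : 'rV[R]_d) : R :=
  Num.sqrt (\sum_(i < d) x ord0 i ^+ 2).

Definition levy_class (R : realType) (d k : nat)
    (nu : {measure set (Rd R d) -> \bar R}) : Prop :=
  nu [set (0 : 'rV[R]_d)] = 0%E /\
  (\int[nu]_x (Order.min 1 (enorm x ^+ k))%:E < +oo)%E.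

Definition a_ker (R : realType) (k : nat) (r s : R) : R :=
  if k == 1%N then
    (if (0 < r) && (r < Num.sqrt s) then 2 / pi * (Num.sqrt (s - r ^+ 2))^-1
     else 0)
  else
    (if (0 < r) && (r < s) then 2 / pi * (Num.sqrt (s ^+ 2 - r ^+ 2))^-1
     else 0).

Definition A_op (R : realType) (d k : nat)
    (nu : {measure set (Rd R d) -> \bar R}) (B : set 'rV[R]_d) : \bar R :=
  (\int[nu]_(x in [set~ (0%R : 'rV[R]_d)])
     \int[lebesgue_measure]_(r in `]0%R, +oo[%classic)
        ((a_ker k r (enorm x))%:E * (\1_B ((r / enorm x) *: x))%:E))%E.

Definition nu_pow (R : realType) (d : nat) (p : R)
    (nu : {measure set (Rd R d) -> \bar R}) (C : set 'rV[R]_d) : \bar R :=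
  nu [set x : 'rV[R]_d | x != 0 /\ C ((enorm x `^ p / enorm x) *: x)].

Definition inv_scale (R : realType) (d : nat) (u : R) (B : set 'rV[R]_d)
  : set 'rV[R]_d := [set u^-1 *: x | x in B].

(* Main.v *)
(* Both kernels are rescalings of the arcsine density
   w(u) = 2 / (pi sqrt (1 - u^2)) on ]0, 1[: with c = |x|^(k/2),
   a_k(r; |x|) = w(r / c) / c.  The substitution r = c u turns A_k(nu)(B) into
   the integral of w(u) 1_B(u c x / |x|) over nu(dx) du, and Tonelli's theorem
   exchanges the two integrals.  It applies because the Levy condition makes nu
   sigma-finite, by Markov's inequality for 1 /\ |x|^k. *)
Require Import Defs.
From HB Require Import structures.
From mathcomp Require Import all_boot all_order all_algebra.
From mathcomp Require Import all_classical all_reals all_analysis.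
From mathcomp Require Import measurable_realfun.
Import Order.TTheory GRing.Theory Num.Theory.
Import numFieldNormedType.Exports.
Local Open Scope classical_set_scope.
Local Open Scope ring_scope.

Set Implicit Arguments.

(** * Tonelli's theorem with sigma-finiteness as a hypothesis *)

Section fubini_sigma_finite.
Context dX dY (X : measurableType dX) (Y : measurableType dY) (R : realType).
Variable mu : {measure set X -> \bar R}.

(* Carries the proof of sigma-finiteness in its type, so that it can be the key
   of a canonical instance. *)
Definition sigma_finite_alias (smu : sigma_finite setT mu) :
  set X -> \bar R := mu.

HB.instance Definition _ smu := Measure.on (sigma_finite_alias smu).

HB.instance Definition _ (smu : sigma_finite setT mu) :=
  Measure_isSigmaFinite.Build _ _ _ (sigma_finite_alias smu) smu.

(** The alias unfolds to [mu] and is an instance of sigma-finite measures, so Tonelli's theorem for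
    the alias is the claim up to conversion. *)
Lemma fubini_tonelli_sigma_finite (nu : {sigma_finite_measure set Y -> \bar R})
    (f : X * Y -> \bar R) : sigma_finite setT mu ->
  measurable_fun setT f -> (forall xy, 0 <= f xy)%E ->
  (\int[mu]_x \int[nu]_y f (x, y) = \int[nu]_y \int[mu]_x f (x, y))%E.
Proof.
by move=> smu; exact: (@fubini_tonelli _ _ _ _ _ (sigma_finite_alias smu)).
Qed.

End fubini_sigma_finite.

Section polar_scaling.
Context {R : realType}.

(** * Borel measurability on [Rd] *)

Lemma measurable_sqrt : measurable_fun [set: R] Num.sqrt.
Proof. by apply: continuous_measurable_fun; exact: sqrt_continuous. Qed.

Lemma measurable_coord d (i : 'I_d) :
  measurable_fun [set: Rd R d] (fun x : Rd R d => (x : 'rV[R]_d) ord0 i).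
Proof.
apply: (measurability _ (RGenOpens.measurableE R)).
move=> _ [_ [a [b ->]] <-]; rewrite setTI; apply: sub_sigma_algebra.
have /continuousP := @coord_continuous R 1 d ord0 i; apply.
exact: interval_open.
Qed.

Lemma measurable_enorm d : measurable_fun [set: Rd R d] (@enorm R d).
Proof.
apply: measurableT_comp; first exact: measurable_sqrt.
apply: measurable_sum => i; apply: measurable_funX; exact: measurable_coord.
Qed.

(** Rational centres and radii make this family of balls countable. *)
Definition rat_ball {d} (qe : 'rV[rat]_d * rat) : set 'rV[R]_d :=
  ball (map_mx ratr qe.1 : 'rV[R]_d) (ratr qe.2 : R).

(** If the ball of radius [e] at [x] lies in [A], take a rational radius below [e / 2] and a
    rational centre within that radius of [x]; the triangle inequality keeps the new ball inside
    [A]. *)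
Lemma open_bigcup_rat_ball d (A : set 'rV[R]_d) : open A ->
  A = \bigcup_(qe in [set qe | rat_ball qe `<=` A]) rat_ball qe.
Proof.
move=> oA; apply/seteqP; split => [x Ax|x [qe] /= + xq]; last by apply.
have /nbhs_ballP[e /= e0 eA] : nbhs x A by exact: open_nbhs_nbhs.
have [r /itvP er] : exists r : rat, (ratr r : R) \in `]0, (e / 2)[.
  by apply: rat_in_itvoo; rewrite divr_gt0.
have r0 : 0 < (ratr r : R) by rewrite er.
have q_ i : exists q : rat,
    (ratr q : R) \in `](x ord0 i - ratr r), (x ord0 i + ratr r)[.
  by apply: rat_in_itvoo; rewrite ltrBlDr -addrA ltrDl addr_gt0.
have [q Hq] := choice q_.
have xq : ball (map_mx ratr (\row_i q i) : 'rV[R]_d) (ratr r) x.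
  split=> // i j; rewrite ord1 !mxE /ball/=.
  have := Hq j; rewrite in_itv/= => h1.
  by rewrite ltr_distl h1.
exists (\row_i q i, r) => //= y qy; apply: eA.
apply: le_ball (ball_triangle (ball_sym xq) qy).
by rewrite [leRHS]splitr lerD// er.
Qed.

(** It suffices to treat preimages of open sets. These are countable unions of preimages of rational
    balls, and a ball for the sup norm is a finite intersection of conditions on single
    coordinates. *)
Lemma measurable_funP_coord dT (T : measurableType dT) d (f : T -> Rd R d) :
  (forall i, measurable_fun setT (fun t => (f t : 'rV[R]_d) ord0 i)) ->
  measurable_fun setT f.
Proof.
move=> mf; apply: (@measurability _ _ T (Rd R d) setT f (@open 'rV[R]_d)) => //.
move=> _ [A oA <-]; rewrite setTI (open_bigcup_rat_ball oA) preimage_bigcup.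
(* Balls not contained in [A] are replaced by the empty set, so that the union runs over a whole
   countable type. *)
rewrite bigcup_mkcond; apply: countable_bigcupT_measurable => // -[q r].
case: ifP => // _.
(* Matrix balls require a positive radius explicitly, which the coordinate
   conditions do not give when d = 0. *)
have [r0|r0] := ltP 0 (ratr r : R); last first.
  rewrite [X in measurable X](_ : _ = set0)//.
  by apply/seteqP; split => // t [/=]; rewrite ltNge r0.
rewrite [X in measurable X](_ : _ = \bigcap_(i in [set: 'I_d])
   ((fun t => (f t : 'rV[R]_d) ord0 i) @^-1`
     ball (ratr (q ord0 i) : R) (ratr r))).
  apply: fin_bigcap_measurable => // i _; rewrite -[X in measurable X]setTI.
  by apply: mf => //; exact: measurable_ball.
apply/seteqP; split => t /=.
  by move=> [_ h] i _ /=; have := h ord0 i; rewrite mxE.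
by move=> h; split=> // i j; rewrite ord1 mxE; exact: h.
Qed.

(** * Lebesgue measure and integral under dilations *)

Notation mu := (@lebesgue_measure R).

(** The right-hand side is a measure in [A] that gives each interval []a, b]] its length, and
    Lebesgue measure is the only such measure. *)
Lemma lebesgue_measure_scale (c : R) (A : set R) : 0 < c -> measurable A ->
  mu A = (c%:E * mu ( *%R c @^-1` A))%E.
Proof.
move=> c0 mA.
have mc : measurable_fun [set: measurableTypeR R]
    ( *%R c : measurableTypeR R -> measurableTypeR R).
  by apply: measurable_funM => //; exact: measurable_cst.
pose nu : {measure set (measurableTypeR R) -> \bar R} :=
  mscale (NngNum (ltW c0))
    (pushforward mu ( *%R c : measurableTypeR R -> measurableTypeR R)).
rewrite -[RHS]/(nu mc A); apply: lebesgue_measure_unique A mA => _ [[a b]] _ <-.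
have preimageE : *%R c @^-1` `]a, b] = `](a / c), (b / c)]%classic.
  apply/seteqP; split => x; rewrite /= !in_itv/=.
    by rewrite ltr_pdivrMr// ler_pdivlMr// ![x * _]mulrC.
  by rewrite ltr_pdivrMr// ler_pdivlMr// ![x * _]mulrC.
rewrite -[RHS]/(c%:E * mu ( *%R c @^-1` `]a, b]))%E preimageE.
rewrite !lebesgue_measure_itv/= !lte_fin ltr_pM2r ?invr_gt0//.
case: ifP => _; last by rewrite mule0.
by rewrite -!EFinB -EFinM -mulrBl mulrC divfK// gt_eqF.
Qed.

Lemma ge0_integral_scale (c : R) (f : R -> \bar R) : 0 < c ->
  measurable_fun [set: R] f -> (forall r, 0 <= f r)%E ->
  (\int[mu]_r f r = \int[mu]_u (c%:E * f (c * u)%R))%E.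
Proof.
move=> c0 mf f0.
have mc : measurable_fun [set: measurableTypeR R]
    ( *%R c : measurableTypeR R -> measurableTypeR R).
  by apply: measurable_funM => //; exact: measurable_cst.
pose nu : {measure set (measurableTypeR R) -> \bar R} :=
  pushforward mu ( *%R c : measurableTypeR R -> measurableTypeR R).
transitivity (\int[mscale (NngNum (ltW c0)) (nu mc)]_r f r)%E.
  by apply: eq_measure_integral => A mA _; exact: lebesgue_measure_scale.
rewrite ge0_integral_mscale//= /nu ge0_integral_pushforward//=.
rewrite preimage_setT ge0_integralZl//=.
- exact: measurableT_comp.
- by rewrite lee_fin ltW.
Qed.

(** * The arcsine density and the two kernels *)

Definition arcsine_density (u : R) : R :=
  if (0 < u) && (u < 1) then 2 / pi * (Num.sqrt (1 - u ^+ 2))^-1 else 0.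

Lemma arcsine_density_ge0 u : 0 <= arcsine_density u.
Proof.
rewrite /arcsine_density; case: ifP => // _.
by rewrite mulr_ge0 ?invr_ge0 ?sqrtr_ge0// divr_ge0// pi_ge0.
Qed.

Lemma measurable_arcsine_density : measurable_fun [set: R] arcsine_density.
Proof.
apply: measurable_fun_ifT => //.
  by apply: measurable_and; apply: measurable_fun_ltr.
apply: measurable_funM => //.
(* The inverse becomes a power with exponent -1, a measurable function on all of [R]; the two agree
   at 0 as well. *)
under eq_fun do rewrite -powR_inv1 ?sqrtr_ge0//.
apply: (measurableT_comp (@measurable_powR R (-1))).
apply: (measurableT_comp measurable_sqrt).
by apply: measurable_funB => //; exact: measurable_funX.
Qed.

(** With [q = s] for [k = 1] and [q = s ^+ 2] for [k = 2], both kernels read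
    [2 / pi * (Num.sqrt (q - r ^+ 2))^-1] on []0, c[] with [c = Num.sqrt q]; it remains to take [c]
    out of the root. *)
Lemma a_ker_arcsine (k : nat) (s r : R) : k = 1%N \/ k = 2%N -> 0 < s ->
  let c := s `^ (k%:R / 2) in
  a_ker k r s = c^-1 * arcsine_density (c^-1 * r).
Proof.
move=> hk s0 c; have c0 : 0 < c by exact: powR_gt0.
pose q := if k == 1%N then s else s ^+ 2.
have cE : c = Num.sqrt q.
  rewrite /c /q; case: hk => ->/=; first by rewrite mul1r powR12_sqrt// ltW.
  by rewrite divff// powRr1 ?ltW// sqrtr_sqr gtr0_norm.
have q0 : 0 < q by rewrite -sqrtr_gt0 -cE.
have -> : a_ker k r s = if (0 < r) && (r < c) then
    2 / pi * (Num.sqrt (q - r ^+ 2))^-1 else 0.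
  by rewrite /a_ker cE /q; case: (k == 1%N); rewrite ?sqrtr_sqr ?gtr0_norm.
rewrite /arcsine_density pmulr_rgt0 ?invr_gt0// ltr_pdivrMl// mulr1.
case: ifP => _; last by rewrite mulr0.
rewrite mulrCA -invfM; congr (_ / _).
by rewrite {1}cE -sqrtrM ?ltW// mulrBr mulr1 exprMn exprVn cE sqr_sqrtr
  ?ltW// mulVKf// gt_eqF.
Qed.

(** * The Euclidean norm and sigma-finiteness of Lévy measures *)

Lemma enorm_gt0 d (x : 'rV[R]_d) : x != 0 -> 0 < enorm x.
Proof.
move=> x0; rewrite sqrtr_gt0 lt_neqAle.
rewrite sumr_ge0 ?andbT => [|i _]; last exact: sqr_ge0.
apply: contra x0 => /eqP/esym x0; apply/eqP/rowP => i; rewrite mxE.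
have /(_ i isT)/eqP := psumr_eq0P (fun i _ => sqr_ge0 (x ord0 i)) x0.
by rewrite sqrf_eq0 => /eqP.
Qed.

Lemma enorm0 d : enorm (0 : 'rV[R]_d) = 0.
Proof.
by rewrite /enorm big1 ?sqrtr0// => i _; rewrite mxE expr0n.
Qed.

Lemma measurable_singleton0 d : measurable [set (0 : 'rV[R]_d) : Rd R d].
Proof.
rewrite [X in measurable X](_ : _ = (@enorm R d : Rd R d -> R) @^-1` [set 0]).
  by rewrite -[X in measurable X]setTI; exact: measurable_enorm.
apply/seteqP; split => [x ->|x /= ex0]; first exact: enorm0.
by apply/eqP/negPn/negP => /enorm_gt0; rewrite ex0 ltxx.
Qed.

Lemma levy_class_sigma_finite d k (nu : {measure set (Rd R d) -> \bar R}) :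
  levy_class k nu -> sigma_finite setT nu.
Proof.
move=> [nu0 nuoo].
pose g (x : Rd R d) : R := Order.min 1 (enorm x ^+ k).
have mg : measurable_fun setT g.
  apply: measurable_minr => //; apply: measurable_funX.
  exact: measurable_enorm.
have g0 x : 0 <= g x by rewrite /g le_min ler01 exprn_ge0// sqrtr_ge0.
(* The null set of the origin comes first; the superlevel sets of [g] exhaust the rest because [g]
   is positive off the origin. *)
exists (fun n => if n is m.+1 then [set x | m.+1%:R^-1 <= g x]
                 else [set (0 : 'rV[R]_d)]).
  apply/esym/seteqP; split => // x _.
  have [->|x0] := eqVneq x (0 : 'rV[R]_d); first by exists 0%N.
  have gx0 : 0 < g x by rewrite /g lt_min ltr01 exprn_gt0// enorm_gt0.
  (* Index [m.+1] stands for level [m.+1%:R^-1], so [m] is the integer part of [(g x)^-1]. *)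
  exists (Num.trunc (g x)^-1).+1 => //=.
  by rewrite invf_ple ?posrE// ltW// truncnS_gt// invr_ge0.
case=> [|n]; split.
- exact: measurable_singleton0.
- by rewrite nu0.
- rewrite [X in measurable X](_ : _ = g @^-1` `[n.+1%:R^-1, +oo[); last first.
    by apply/seteqP; split => x; rewrite /= in_itv/= andbT.
  by rewrite -[X in measurable X]setTI; exact: mg.
- have n0 : 0 < n.+1%:R^-1 :> R by rewrite invr_gt0.
  have /measurable_EFinP mEg := mg.
  have := le_integral_abse nu measurableT mEg n0.
  under [leRHS]eq_integral do rewrite /= ger0_norm//.
  move=> /le_lt_trans/(_ nuoo); rewrite setTI.
  rewrite (_ : [set _ | _] = [set x | n.+1%:R^-1 <= g x]); last first.
    by apply/seteqP; split => x; rewrite /= lee_fin ger0_norm.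
  (* Markov's inequality bounds the level times the mass; infinite mass times a positive level would
     be infinite. *)
  rewrite !ltNge => /negP h; apply/negP => /=; rewrite leye_eq => /eqP e.
  by apply: h; rewrite e gt0_muley// lte_fin.
Qed.

(** The point [u |x|^p x / |x|], taken jointly in [x] and [u] so that Tonelli's theorem can be
    applied to its indicator. *)
Definition ray (p : R) {d} (xu : Rd R d * R) : Rd R d :=
  (xu.2 * (enorm xu.1 `^ p / enorm xu.1)) *: (xu.1 : 'rV[R]_d).

Lemma measurable_ray p d : measurable_fun [set: Rd R d * R] (ray p (d := d)).
Proof.
have me : measurable_fun [set: Rd R d * R] (fun xu => enorm xu.1).
  by apply: measurableT_comp measurable_fst; exact: measurable_enorm.
apply: measurable_funP_coord => i; under eq_fun do rewrite mxE.
apply: measurable_funM; last first.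
  exact: (measurableT_comp (measurable_coord i) measurable_fst).
apply: measurable_funM => //; apply: measurable_funM.
  exact: (measurableT_comp (@measurable_powR R p) me).
under eq_fun do rewrite -powR_inv1 ?sqrtr_ge0//.
exact: (measurableT_comp (@measurable_powR R (-1)) me).
Qed.

End polar_scaling.

Unset Implicit Arguments.

Theorem theorem2p13 (R : realType) (d k : nat) (hk : k = 1%N \/ k = 2%N)
    (nu : {measure set (Rd R d) -> \bar R}) (hnu : levy_class k nu)
    (B : set (Rd R d)) (hB : measurable B) :
  A_op k nu B =
  (\int[lebesgue_measure]_(u in `]0%R, 1%R[%classic)
     (nu_pow (k%:R / 2) nu (inv_scale u B) *
      (2 / pi * (Num.sqrt (1 - u ^+ 2))^-1)%:E))%E.
Proof.
pose p : R := k%:R / 2.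
(* Excluding the origin here accounts both for the domain of integration in [A_op] and for the
   condition in [nu_pow]. *)
pose C : set (Rd R d * R) :=
  [set xu | (xu.1 : 'rV[R]_d) != 0 /\ B (ray p xu)].
have mn0 : measurable [set~ (0 : 'rV[R]_d) : Rd R d].
  by apply: measurableC; exact: measurable_singleton0.
have mC : measurable C.
  rewrite (_ : C = fst @^-1` [set~ (0 : 'rV[R]_d) : Rd R d] `&`
      ray p @^-1` B).
    apply: measurableI; rewrite -[X in measurable X]setTI.
      exact: measurable_fst.
    exact: measurable_ray.
  by apply/seteqP; split => x [/eqP x0 Bx].
have mIC : measurable_fun setT (\1_C : _ -> R) by exact: measurable_indic.
pose g (xu : Rd R d * R) : \bar R :=
  ((arcsine_density xu.2)%:E * (\1_C xu)%:E)%E.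
have mg : measurable_fun setT g.
  apply: emeasurable_funM; apply/measurable_EFinP.
    exact: (measurableT_comp measurable_arcsine_density measurable_snd).
  exact: mIC.
have g0 xu : (0 <= g xu)%E.
  by rewrite mule_ge0// lee_fin// arcsine_density_ge0.
transitivity (\int[nu]_x \int[lebesgue_measure]_u g (x, u))%E.
  rewrite /A_op [LHS]integral_mkcond; apply: eq_integral => x _.
  rewrite patchE; case: ifPn => [|/negP x0]; last first.
    rewrite integral0_eq// => u _.
    rewrite /g indicE memNset ?mule0//= => -[/eqP x1 _].
    by apply: x0; rewrite inE.
  rewrite inE/= => /eqP x0.
  have s0 : 0 < enorm x by exact: enorm_gt0.
  have c0 : 0 < (enorm x `^ p) by exact: powR_gt0.
  rewrite integral_mkcond [RHS](ge0_integral_scale (enorm x `^ p)^-1)//.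
  - apply: eq_integral => r _.
    rewrite /g/= muleA -EFinM -a_ker_arcsine// patchE.
    have Cr : \1_C (x, (enorm x `^ p)^-1 * r) = \1_B ((r / enorm x) *: x) :> R.
      rewrite !indicE; congr (_ %:R); rewrite /C/ray/=; congr (nat_of_bool _).
      apply/idP/idP; rewrite !inE/= mulrA -(mulrC r) mulfVK ?gt_eqF//.
      by case.
    rewrite Cr; case: ifPn => //.
    rewrite notin_setE/= in_itv/= andbT => /negP r0.
    by rewrite /a_ker (negbTE r0)/= if_same mul0r.
  - by rewrite invr_gt0.
  - exact: (measurableT_comp mg (pair1_measurable x)).
rewrite fubini_tonelli_sigma_finite//; last exact: levy_class_sigma_finite hnu.
rewrite [RHS]integral_mkcond; apply: eq_integral => u _.
rewrite patchE /g/=; case: ifPn => u01; last first.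
  rewrite integral0_eq// => x _; rewrite /arcsine_density ifF ?mul0e//.
  by apply: contraNF u01; rewrite inE/= in_itv.
move: u01; rewrite inE/= in_itv/= => u01; have [u0 u1] := andP u01.
rewrite ge0_integralZl//; last 2 first.
- apply/measurable_EFinP.
  exact: (measurableT_comp mIC (pair2_measurable u)).
- by rewrite lee_fin arcsine_density_ge0.
rewrite muleC /arcsine_density u01; congr (_ * _)%E.
rewrite (_ : (fun x => _) = (fun x => (\1_(ysection C u) x)%:E)); last first.
  by apply/funext => x; rewrite !indicE; congr (_ %:R%:E); rewrite mem_ysection.
rewrite integral_indic//; last exact: measurable_ysection.
(* For [u > 0], the point [ray p (x, u)] lies in [B] exactly when its quotient by [u] lies in
   [inv_scale u B]. *)
rewrite setIT /nu_pow; congr (nu _); apply/seteqP; split => x.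
  rewrite ysectionE /= => -[x0 Bx]; split => //; exists (ray p (x, u)) => //.
  by rewrite /ray/= scalerA mulKf// gt_eqF.
move=> [x0 [y By yE]]; rewrite ysectionE; split => //=.
by rewrite /ray/= -scalerA -yE scalerA divff ?gt_eqF// scale1r.
Qed.
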